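(* Let $G_1$ and $G_2$ be graphs with $E(G_1)\cap E(G_2)=\{e\}$, where $e=xy$, and $V(G_1)\cap V(G_2)=\{x,y\}$. Let $G$ be the two-sum of $G_1$ and $G_2$, i.e. the graph with vertex set $V(G_1)\cup V(G_2)$ and edge set $E(G_1)\cup E(G_2)$. Let $a\in V(G_1)$ and $b\in V(G_2)$ with $\{a,b\}\cap\{x,y\}=\varnothing$, and write $d=d_G$. Then $S(G,a,b)$ is isomorphic to one of the following: (i) the disjoint union of $S(G_1,a,x)\,\square\,S(G_2,x,b)$ and $S(G_1,a,y)\,\square\,S(G_2,y,b)$ plus additional edges which comprise a matching between the two, in the case that $d(a,x)=d(a,y)$ and $d(x,b)=d(y,b)$; (ii) $S(G_1,a,x)\,\square\,S(G_2,x,b)$, in the case that $d(a,x)\le d(a,y)$ and $d(x,b)<d(y,b)$, or $d(a,x)<d(a,y)$ and $d(x,b)\le d(y,b)$; (iii) $S(G_1,a,y)\,\square\,S(G_2,y,b)$, in the case that $d(a,y)\le d(a,x)$ and $d(y,b)<d(x,b)$, or $d(a,y)<d(a,x)$ and $d(y,b)\le d(x,b)$; (iv) otherwise, the (not necessarily disjoint) union of $S(G_1,a,x)\,\square\,S(G_2,x,b)$ and $S(G_1,a,y)\,\square\,S(G_2,y,b)$, where the vertices common to the two correspond precisely to the $a,b$-geodesics containing the edge $e$; that is, $S(G,a,b)=H_x\cup H_y$ for subgraphs $H_x\cong S(G_1,a,x)\,\square\,S(G_2,x,b)$ and $H_y\cong S(G_1,a,y)\,\square\,S(G_2,y,b)$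 such that $V(H_x)\cap V(H_y)$ is exactly the set of $a,b$-geodesics of $G$ containing $e$.
   Context: Graphs are finite and simple. For a graph $G$ with distinct vertices $a,b$, an $a,b$-geodesic is a path between $a$ and $b$ of length $d_G(a,b)$. The shortest path graph $S(G,a,b)$ is the graph whose vertices are the $a,b$-geodesics in $G$, two of them being adjacent if and only if the corresponding paths differ in exactly one vertex. The union of two graphs has as vertex set the union of the vertex sets and as edge set the union of the edge sets. A matching between two vertex-disjoint graphs is a set of edges, each with one endpoint in each graph, no two sharing an endpoint. The Cartesian product $H_1\,\square\,H_2$ has vertex set $V(H_1)\times V(H_2)$, with $(x_1,x_2)$ adjacent to $(y_1,y_2)$ if and only if either $x_1=y_1$ and $x_2\sim y_2$ in $H_2$, or $x_1\sim y_1$ in $H_1$ and $x_2=y_2$. *)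

(* Defs.v *)
From HB Require Import structures.
From mathcomp Require Import all_boot.

Set Implicit Arguments.
Unset Strict Implicit.
Unset Printing Implicit Defensive.

(* A finite simple graph whose vertices form a subset of a finite ambient type,
   so that intersections and unions of vertex and edge sets of graphs over the
   same ambient type are literal. *)
Record graph (T : finType) := Graph {
  vset : {set T};
  eset : {set {set T}};
  esetP : [forall e in eset, (e \subset vset) && (#|e| == 2)] }.

Definition adj (T : finType) (G : graph T) : rel T :=
  fun u v => [set u; v] \in eset G.

Section GraphOfRelation.
Variables (T : finType) (V : {set T}) (r : rel T).

Definition rel_eset : {set {set T}} :=
  [set e | [exists u in V, exists v in V,
     [&& u != v, r u v & e == [set u; v]]]].

Fact rel_esetP : [forall e in rel_eset, (e \subset V) && (#|e| == 2)].
Proof.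
apply/forall_inP => e; rewrite inE => /exists_inP[u uV /exists_inP[v vV]].
case/and3P=> uv _ /eqP ->; rewrite cards2 uv eqxx andbT.
by apply/subsetP => w; rewrite !inE => /orP[] /eqP ->.
Qed.

(* Only meant for relations r that are symmetric on V. *)
Definition rel_graph : graph T := Graph rel_esetP.
End GraphOfRelation.

Definition subgraph (T : finType) (H G : graph T) : bool :=
  (vset H \subset vset G) && (eset H \subset eset G).

Section Union.
Variables (T : finType) (G H : graph T).

Fact gunionP : [forall e in eset G :|: eset H,
  (e \subset vset G :|: vset H) && (#|e| == 2)].
Proof.
apply/forall_inP => e; rewrite inE.
case/orP=> [eG|eH].
  have /forall_inP/(_ e eG)/andP[sub ->] := esetP G.
  by rewrite (subset_trans sub) ?subsetUl.
have /forall_inP/(_ e eH)/andP[sub ->] := esetP H.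
by rewrite (subset_trans sub) ?subsetUr.
Qed.

Definition gunion : graph T := Graph gunionP.
End Union.

Section Image.
Variables (T U : finType) (f : T -> U) (f_inj : injective f) (G : graph T).

Fact gimageP : [forall e in [set f @: e | e : {set T} in eset G],
  (e \subset f @: vset G) && (#|e| == 2)].
Proof.
apply/forall_inP => _ /imsetP[e eG ->].
have /forall_inP/(_ e eG)/andP[sub e2] := esetP G.
by rewrite imsetS //= card_imset.
Qed.

Definition gimage : graph U := Graph gimageP.
End Image.

Fact inl_inj (T U : finType) : injective (@inl T U).
Proof. by move=> ? ? []. Qed.

Fact inr_inj (T U : finType) : injective (@inr T U).
Proof. by move=> ? ? []. Qed.

Definition ginl (T U : finType) (G : graph T) : graph (T + U)%type :=
  gimage (@inl_inj T U) G.

Definition ginr (T U : finType) (H : graph U) : graph (T + U)%type :=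
  gimage (@inr_inj T U) H.

Definition disjoint_gunion (T U : finType) (G : graph T) (H : graph U) :
    graph (T + U)%type :=
  gunion (ginl U G) (ginr T H).

Definition matching_between (T : finType) (G H : graph T) (M : {set {set T}}) :
    Prop :=
  (forall e, e \in M ->
     exists u v, [/\ u \in vset G, v \in vset H & e = [set u; v]])
  /\ trivIset M.

Definition cartesian (T U : finType) (G : graph T) (H : graph U) :
    graph (T * U)%type :=
  rel_graph (setX (vset G) (vset H))
    (fun p q => (p.1 == q.1) && adj H p.2 q.2
             || adj G p.1 q.1 && (p.2 == q.2)).

(* The bijection is between the vertex sets, not between the ambient types. *)
Definition iso (T U : finType) (G : graph T) (H : graph U) : Prop :=
  exists f : {u : T | u \in vset G} -> {u : U | u \in vset H},
    bijective f /\
    forall u v, adj G (val u) (val v) = adj H (val (f u)) (val (f v)).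

Section Geodesics.
Variables (T : finType) (G : graph T).

(* s lists all the vertices of the path, both ends included. *)
Definition is_path (u v : T) (s : seq T) : bool :=
  if s is w :: t then
    [&& w == u, last w t == v, all (mem (vset G)) s, path (adj G) w t & uniq s]
  else false.

(* The least length of a path from u to v. When there is no such path this is
   #|T|, which exceeds the length of every path and plays the role of infinity
   (in particular no path has length #|T|). *)
Definition dist (u v : T) : nat :=
  find (fun n => [exists s : n.+1.-tuple T, is_path u v s]) (iota 0 #|T|).

Definition geodesic (u v : T) (s : seq T) : bool :=
  is_path u v s && (size s == (dist u v).+1).

Definition differ_in_one_vertex (s t : seq T) : bool :=
  (size s == size t) && (count (fun p => p.1 != p.2) (zip s t) == 1).

(* A path has at most #|T| vertices, so bounded sequences hold all geodesics. *)
Definition geodesics (u v : T) : {set #|T|.-bseq T} :=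
  [set s : #|T|.-bseq T | geodesic u v s].

Definition spg (u v : T) : graph (#|T|.-bseq T) :=
  rel_graph (geodesics u v) (fun s t => differ_in_one_vertex s t).

Definition path_edges (s : seq T) : seq {set T} :=
  [seq [set p.1; p.2] | p <- zip s (behead s)].
End Geodesics.

(* Main.v *)
(* Every path from a to b meets {x, y}, and a geodesic between two vertices of
   G1 (or of G2) stays there, since leaving and coming back would use both x and
   y, which are adjacent. Hence concatenation at x identifies the a,b-geodesics
   through x with pairs of geodesics, and "differ in one vertex" becomes the
   Cartesian product adjacency; likewise at y. An a,b-geodesic meeting x has x
   at index d(a,x), and similarly for y. So if d(a,x) = d(a,y), two adjacent
   geodesics through x and through y differ exactly at that index, which gives a
   matching; if d(a,x) and d(a,y) differ, then adjacent geodesics have one of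
   x, y in common. *)

Require Import Defs.
From mathcomp Require Import all_boot zify.

Set Implicit Arguments.
Unset Strict Implicit.
Unset Printing Implicit Defensive.

(** * Edges and adjacency in finite graphs *)

Lemma graph_eq (T : finType) (G H : graph T) :
  vset G = vset H -> eset G = eset H -> G = H.
Proof.
case: G H => [V E p] [V' E' p'] /= eqV eqE; subst V' E'.
by rewrite (bool_irrelevance p p').
Qed.

Lemma gunionC (T : finType) (G H : graph T) : gunion G H = gunion H G.
Proof. by apply: graph_eq; rewrite /= setUC. Qed.

Lemma adj_sym (T : finType) (G : graph T) : symmetric (adj G).
Proof. by move=> u v; rewrite /adj setUC. Qed.

Lemma adj_vset (T : finType) (G : graph T) u v :
  adj G u v -> [/\ u \in vset G, v \in vset G & u != v].
Proof.
move=> uv; have /forall_inP/(_ _ uv)/andP[/subsetP sub] := esetP G.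
rewrite cards2 => c2; split; last by case: (u =P v) c2.
  by apply: sub; rewrite set21.
by apply: sub; rewrite set22.
Qed.

Lemma eset_adj (T : finType) (G : graph T) e :
  e \in eset G -> exists u v, e = [set u; v].
Proof.
move=> eG; have /forall_inP/(_ _ eG)/andP[_ /cards2P[u [v [_ ->]]]] := esetP G.
by exists u, v.
Qed.

Lemma eset_eqP (T : finType) (G H : graph T) :
  adj G =2 adj H -> eset G = eset H.
Proof.
move=> eqGH; apply/setP=> e; apply/idP/idP => eE.
  have [u [v ee]] := eset_adj eE; move: eE; rewrite ee => eE.
  by rewrite -[_ \in _]/(adj H u v) -eqGH.
have [u [v ee]] := eset_adj eE; move: eE; rewrite ee => eE.
by rewrite -[_ \in _]/(adj G u v) eqGH.
Qed.

Lemma set2_eq (T : finType) (a b c d : T) : [set a; b] = [set c; d] ->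
  (a = c /\ b = d) \/ (a = d /\ b = c).
Proof.
move/setP=> eqs; have := eqs a; have := eqs b; have := eqs c; have := eqs d.
rewrite !inE !eqxx !orbT => /pred2P hd /pred2P hc /esym/pred2P hb /esym/pred2P ha.
by case: ha; case: hb; case: hc; case: hd; intuition congruence.
Qed.

Lemma adj_gunion (T : finType) (G H : graph T) u v :
  adj (gunion G H) u v = adj G u v || adj H u v.
Proof. by rewrite /adj inE. Qed.

Lemma adj_rel_graph (T : finType) (V : {set T}) (r : rel T) :
    {in V &, symmetric r} -> forall u v,
  adj (rel_graph V r) u v = [&& u \in V, v \in V, u != v & r u v].
Proof.
move=> sym_r u v; rewrite /adj inE; apply/exists_inP/idP => [|].
  case=> u' u'V /exists_inP[v' v'V /and3P[neq ruv /eqP/set2_eq]].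
  case=> [] [-> ->]; first by rewrite u'V v'V neq.
  by rewrite u'V v'V eq_sym neq sym_r.
by case/and4P=> uV vV neq ruv; exists u => //; apply/exists_inP; exists v;
  rewrite ?neq ?ruv //=.
Qed.

(** * Sequences that differ in exactly one position *)

Section DifferInOneVertex.
Variable T : finType.

Lemma count_differ_eq0 (s t : seq T) : size s = size t ->
  (count (fun p => p.1 != p.2) (zip s t) == 0) = (s == t).
Proof.
elim: s t => [|z s IHs] [|w t] //= [/IHs]; rewrite eqseq_cons => <-.
by rewrite addn_eq0; case: (z == w).
Qed.

(** The single differing position is [i]. The default [z] is harmless: the sizes agree, so an index
    past the end reads [z] on both sides. *)
Lemma differ_in_one_vertexE (s t : seq T) z i :
    differ_in_one_vertex s t -> nth z s i != nth z t i ->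
  forall j, j != i -> nth z s j = nth z t j.
Proof.
case/andP=> /eqP sz /eqP; elim: s t sz i => [|w s IHs] [|w' t] //= [sz] i.
case: i => [|i] /=.
  move=> c1 neq; have /eqP : count (fun p => p.1 != p.2) (zip s t) = 0.
    by move: c1; rewrite neq add1n => -[].
  by rewrite count_differ_eq0 // => /eqP-> [].
(* The tails already differ at [i], so a difference between the heads would bring the count to at
   least two. *)
move=> c1 neq; have cpos : count (fun p => p.1 != p.2) (zip s t) != 0.
  by rewrite count_differ_eq0 //; apply: contra neq => /eqP->.
have ww' : w = w'.
  by apply: contraTeq (introT eqP c1) => ww; rewrite ww add1n eqSS.
case=> [|j] //=; rewrite eqSS; apply: (IHs _ sz i) => //.
by move: c1; rewrite ww' eqxx.
Qed.

Lemma differ_in_one_vertex_neq (s t : seq T) : differ_in_one_vertex s t -> s != t.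
Proof.
by case/andP=> /eqP sz /eqP c1; rewrite -count_differ_eq0 // c1.
Qed.

End DifferInOneVertex.

Lemma differ_in_one_vertex_sym (T : finType) : symmetric (@differ_in_one_vertex T).
Proof.
move=> s t; rewrite /differ_in_one_vertex eq_sym; congr (_ && (_ == _)).
elim: s t => [|z s IHs] [|w t] //=; by rewrite IHs eq_sym.
Qed.

(** The disequality built into [rel_graph] is absorbed, since sequences that differ in one position
    are distinct. *)
Lemma adj_rel_differ (T : finType) n (V : {set n.-bseq T}) s t :
  adj (rel_graph V (fun s t => differ_in_one_vertex s t)) s t =
  [&& s \in V, t \in V & differ_in_one_vertex s t].
Proof.
rewrite adj_rel_graph; last by move=> ? ? _ _; exact: differ_in_one_vertex_sym.
case: (boolP (differ_in_one_vertex s t)); rewrite ?andbF ?andbT //.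
by move/differ_in_one_vertex_neq; rewrite val_eqE => ->; rewrite andbT.
Qed.

(** * Cartesian products and isomorphisms *)

Lemma adj_cartesian (T U : finType) (G : graph T) (H : graph U) p q :
  adj (cartesian G H) p q =
  [&& p \in setX (vset G) (vset H), q \in setX (vset G) (vset H) &
      (p.1 == q.1) && adj H p.2 q.2 || adj G p.1 q.1 && (p.2 == q.2)].
Proof.
rewrite adj_rel_graph => [|p' q' _ _]; last first.
  by rewrite (eq_sym p'.1) (eq_sym p'.2) (adj_sym H) (adj_sym G).
case: (eqVneq p q) => //= ->; rewrite !eqxx andbT andTb; congr [&& _, _ & _].
by apply/esym/norP; split; apply/negP=> /adj_vset[_ _]; rewrite eqxx.
Qed.

(** Lets isomorphisms be given by maps of the ambient types. The restriction to vertices is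
    injective between sets of equal cardinality, hence bijective. *)
Lemma iso_imset (T U : finType) (G : graph T) (H : graph U) (f : T -> U) :
    {in vset G &, injective f} -> f @: vset G = vset H ->
    {in vset G &, forall u v, adj G u v = adj H (f u) (f v)} ->
  iso G H.
Proof.
move=> inj_f fGH fadj.
have fH (u : {u : T | u \in vset G}) : f (val u) \in vset H.
  by rewrite -fGH imset_f // (valP u).
pose g u : {u : U | u \in vset H} := Sub (f (val u)) (fH u).
have inj_g : injective g.
  move=> u v [] /inj_f eq_uv; apply: val_inj; apply: eq_uv; exact: valP.
exists g; split; last by move=> u v; rewrite fadj //; exact: valP.
apply: inj_card_bij => //; rewrite !card_sig -[X in _ <= X](card_in_imset inj_f).
by rewrite fGH.
Qed.

Lemma iso_sym (T U : finType) (G : graph T) (H : graph U) :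
  iso G H -> iso H G.
Proof.
case=> f [[g fK gK] fadj]; exists g; split; first by exists f.
by move=> u v; rewrite fadj !gK.
Qed.

(** * Walks, distances and geodesics *)

Section Walks.
Variables (T : finType) (G : graph T).

(** Dropping [uniq] from [is_path] makes the notion stable under concatenation; [walk_path] and
    [geodesicE] recover paths when needed. *)
Definition walk (u v : T) (s : seq T) : bool :=
  if s is w :: t then
    [&& w == u, last w t == v, all (mem (vset G)) s & path (adj G) w t]
  else false.

Lemma is_pathE u v s : is_path G u v s = walk u v s && uniq s.
Proof. by case: s => //= w t; rewrite -!andbA. Qed.

Lemma walk_cat u v s1 w s2 :
  walk u v (s1 ++ w :: s2) = walk u w (rcons s1 w) && walk w v (w :: s2).
Proof.
case: s1 => [|z s1] /=.
  by rewrite !eqxx andbT /=; case: (w == u); case: (w \in vset G); rewrite //= ?andbF.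
rewrite last_cat /= cat_path all_cat last_rcons all_rcons rcons_path !eqxx /=.
by case: (z == u); case: (_ == v); case: (z \in vset G); case: (w \in vset G);
   case: (all _ s1); case: (all _ s2); case: (path _ z s1); case: (adj _ _ w); rewrite //= ?andbF.
Qed.

Lemma walk_last u v s : walk u v s -> exists s', s = rcons s' v.
Proof.
case: s => //= w t /and4P[_ /eqP <- _ _]; exists (belast w t).
by rewrite -lastI.
Qed.

Lemma walk_head u v s : walk u v s -> exists s', s = u :: s'.
Proof. by case: s => //= w t /and4P[/eqP -> _ _ _]; exists t. Qed.

Lemma walk_vset u v s : walk u v s -> {subset s <= vset G}.
Proof.
case: s => //= w t /and4P[_ _ /andP[wV /allP tV] _] z.
by rewrite inE => /predU1P[-> | /tV].
Qed.

Lemma size_path_le u v s : is_path G u v s -> size s <= #|T|.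
Proof.
rewrite is_pathE => /andP[_ /card_uniqP <-]; exact: max_card.
Qed.

Lemma dist_le_card u v : dist G u v <= #|T|.
Proof. by rewrite /dist (leq_trans (find_size _ _)) ?size_iota. Qed.

(** A path with n edges makes the test searched by [dist] succeed at n, and n lies in the searched
    range because a path has at most [#|T|] vertices. *)
Lemma path_dist u v s : is_path G u v s -> dist G u v < size s.
Proof.
move=> ps; have s_le := size_path_le ps.
have s_gt0 : 0 < size s by case: s ps {s_le}.
rewrite ltnNge; apply/negP => le_d; have := le_d; rewrite -(prednK s_gt0) => lt_d.
have := before_find 0 lt_d; rewrite nth_iota; last by rewrite prednK.
have szP : size s == (size s).-1.+1 by rewrite prednK.
by rewrite add0n => /existsP; case; exists (Tuple szP).
Qed.

Lemma dist_path u v : dist G u v < #|T| ->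
  exists2 s, is_path G u v s & size s = (dist G u v).+1.
Proof.
move=> lt_d; have := lt_d; rewrite {1}/dist -{2}(size_iota 0 #|T|) -has_find => hs.
have := nth_find 0 hs; rewrite nth_iota //.
by rewrite add0n => /existsP[s ps]; exists s => //; rewrite size_tuple.
Qed.

(** The equality case matters: a walk that cannot be shortened has no repeated vertex, which is what
    [geodesicE] uses. *)
Lemma walk_path u v s : walk u v s ->
  exists2 s', is_path G u v s' & size s' <= size s ?= iff uniq s.
Proof.
case: s => //= w t /and4P[wu lst /andP[wV tV] pt].
case: (boolP (uniq (w :: t))) => [un|nun].
  exists (w :: t); last by split; rewrite ?eqxx // -[RHS]un.
  by rewrite is_pathE un /= wu lst wV tV pt.
move: lst nun; case: (shortenP pt) => t' pt' ut' sub lst nun.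
exists (w :: t').
  rewrite is_pathE ut' andbT /= wu lst wV pt' andbT /=.
  by apply/allP => z /sub /(allP tV).
have sub' : {subset w :: t' <= w :: t}.
  by move=> z; rewrite !inE => /orP[->|/sub ->]; rewrite ?orbT.
split; first exact: uniq_leq_size ut' sub'.
(* Equal sizes would force [w :: t] to be duplicate-free, since it contains the duplicate-free
   [w :: t']. *)
rewrite [RHS](negPf nun); apply/eqP => sz; move/negP: nun; apply.
by apply: leq_size_uniq ut' sub' _; rewrite sz.
Qed.

Lemma walk_dist u v s : walk u v s -> dist G u v < size s.
Proof.
by case/walk_path => s' /path_dist lt_d [/(leq_trans lt_d)].
Qed.

Lemma walk_dist_card u v s : walk u v s -> dist G u v < #|T|.
Proof.
case/walk_path => s' ps' _; exact: leq_trans (path_dist ps') (size_path_le ps').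
Qed.

(** Uniqueness of vertices comes for free at minimal length: the path extracted from the walk is no
    shorter than the walk, so the equality case of [walk_path] applies. *)
Lemma geodesicE u v s : geodesic G u v s = walk u v s && (size s == (dist G u v).+1).
Proof.
rewrite /geodesic is_pathE -andbA; case: (boolP (walk u v s)) => //= ws.
case: eqP => sz; rewrite ?andbF ?andbT //.
have [s' /path_dist lt_d [le_s' eq_s']] := walk_path ws.
by rewrite -eq_s' eqn_leq le_s' sz.
Qed.

Lemma geodesic_walk u v s : geodesic G u v s -> walk u v s.
Proof. by rewrite geodesicE => /andP[]. Qed.

Lemma geodesic_size u v s : geodesic G u v s -> size s = (dist G u v).+1.
Proof. by case/andP=> _ /eqP. Qed.

Lemma geodesic_size_le u v s : geodesic G u v s -> size s <= #|T|.
Proof. by case/andP=> /size_path_le. Qed.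

Lemma dist_geodesic u v : dist G u v < #|T| -> exists s, geodesic G u v s.
Proof. by case/dist_path=> s ps sz; exists s; rewrite /geodesic ps sz eqxx. Qed.

Lemma walk_join u w v p q : walk u w p -> walk w v q ->
  walk u v (p ++ behead q) /\ (size (p ++ behead q)).+1 = size p + size q.
Proof.
move=> wp wq; have [p' ep] := walk_last wp; have [q' eq] := walk_head wq.
by subst p q; rewrite /= cat_rcons walk_cat wp wq size_cat size_rcons /= addSn addnS.
Qed.

(** If both distances on the right are finite, geodesics are joined at [w]; otherwise the right side
    is at least [#|T|], which bounds every distance. *)
Lemma dist_triangle w u v : dist G u v <= dist G u w + dist G w v.
Proof.
case: (ltnP (dist G u w) #|T|) => [/dist_geodesic[p gp]|ge_uw]; last first.
  exact: leq_trans (dist_le_card _ _) (leq_trans ge_uw (leq_addr _ _)).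
case: (ltnP (dist G w v) #|T|) => [/dist_geodesic[q gq]|ge_wv]; last first.
  exact: leq_trans (dist_le_card _ _) (leq_trans ge_wv (leq_addl _ _)).
have [wpq] := walk_join (geodesic_walk gp) (geodesic_walk gq).
by have := walk_dist wpq; rewrite (geodesic_size gp) (geodesic_size gq); lia.
Qed.

(** The two pieces are walks whose lengths add up to the distance from [u] to [v]; by the triangle
    inequality neither can exceed the distance between its own ends. *)
Lemma geodesic_split u v s w : geodesic G u v s -> w \in s ->
  exists p q, [/\ geodesic G u w p, geodesic G w v q & s = p ++ behead q].
Proof.
move=> gs ws; case/splitPr: ws gs => s1 s2; rewrite geodesicE walk_cat.
case/andP=> /andP[wp wq] /eqP; rewrite size_cat /= => sz.
exists (rcons s1 w), (w :: s2); rewrite !geodesicE wp wq cat_rcons /=.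
have := walk_dist wp; have := walk_dist wq; have := dist_triangle w u v.
by rewrite /= size_rcons => h1 h2 h3; split => //; apply/eqP; lia.
Qed.

Lemma geodesic_mem_dist u v s w : geodesic G u v s -> w \in s ->
  dist G u v = dist G u w + dist G w v.
Proof.
move=> gs ws; have [p [q [gp gq es]]] := geodesic_split gs ws.
have [_] := walk_join (geodesic_walk gp) (geodesic_walk gq).
by rewrite -es (geodesic_size gs) (geodesic_size gp) (geodesic_size gq); lia.
Qed.

Lemma nth_geodesic_last z u v s : geodesic G u v s -> nth z s (dist G u v) = v.
Proof.
move=> gs; have [s' es] := walk_last (geodesic_walk gs).
have := geodesic_size gs; rewrite es size_rcons nth_rcons => -[->].
by rewrite ltnn eqxx.
Qed.

(** The part of [s] up to [w] is itself a geodesic, so its length fixes the index of [w]. All later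
    arguments comparing positions rest on this. *)
Lemma nth_geodesic z u v s w : geodesic G u v s -> w \in s ->
  nth z s (dist G u w) = w.
Proof.
move=> gs ws; have [p [q [gp gq ->]]] := geodesic_split gs ws.
by rewrite nth_cat (geodesic_size gp) ltnSn (nth_geodesic_last z gp).
Qed.

(** The [minn] accounts for distances being capped at [#|T|]: the hypothesis then also holds when
    [v] is unreachable from [u]. Once [p] and [q] exist, their join makes the distance less than
    [#|T|], so the minimum is the sum. *)
Lemma geodesic_join u w v p q : minn #|T| (dist G u w + dist G w v) <= dist G u v ->
  geodesic G u w p -> geodesic G w v q -> geodesic G u v (p ++ behead q).
Proof.
move=> le_d gp gq; have [wpq sz] := walk_join (geodesic_walk gp) (geodesic_walk gq).
rewrite geodesicE wpq /=; have := walk_dist_card wpq; have := walk_dist wpq.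
move: sz; rewrite (geodesic_size gp) (geodesic_size gq) => sz h1 h2; apply/eqP.
by lia.
Qed.

Lemma geodesic_mem_last u v s : geodesic G u v s -> v \in s.
Proof. by case/geodesic_walk/walk_last => s' ->; rewrite mem_rcons mem_head. Qed.

Lemma dist_adj u v : adj G u v -> dist G u v <= 1.
Proof.
move=> uv; have [uV vV _] := adj_vset uv.
by apply: (@walk_dist u v [:: u; v]); rewrite /= !eqxx uV vV uv.
Qed.

End Walks.

(** The number of differing positions adds up over the two pieces, the shared vertex [w]
    contributing nothing. A total of one means that one piece contributes one and the other zero,
    that is, agrees. *)
Lemma differ_in_one_vertex_join (T : finType) (G : graph T) u w v p q p' q' :
    geodesic G u w p -> geodesic G u w p' -> geodesic G w v q -> geodesic G w v q' ->
  differ_in_one_vertex (p ++ behead q) (p' ++ behead q') =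
  (p == p') && differ_in_one_vertex q q' || differ_in_one_vertex p p' && (q == q').
Proof.
move=> gp gp' gq gq'.
have szp : size p = size p' by rewrite (geodesic_size gp) (geodesic_size gp').
have : size q = size q' by rewrite (geodesic_size gq) (geodesic_size gq').
have [{gq} r ->] := walk_head (geodesic_walk gq).
have [{gq'} r' ->] := walk_head (geodesic_walk gq').
case=> szr; rewrite /differ_in_one_vertex /= eqseq_cons !eqxx !size_cat szp szr !eqxx.
rewrite zip_cat // count_cat -!count_differ_eq0 //=.
by case: (count _ _) (count _ _) => [|[|m]] [|[|n]].
Qed.

(** * Disjoint unions, and relation graphs on smaller vertex sets *)

Lemma adj_gimage (T U : finType) (f : T -> U) (f_inj : injective f) (G : graph T) u v :
  adj (gimage f_inj G) (f u) (f v) = adj G u v.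
Proof.
rewrite /adj /= -(mem_imset (mem (eset G)) [set u; v] (imset_inj f_inj)) /=.
by rewrite imsetU1 imset_set1.
Qed.

Lemma mem_inl_disjoint_gunion (T U : finType) (G : graph T) (H : graph U) p :
  (inl p \in vset (disjoint_gunion G H)) = (p \in vset G).
Proof.
rewrite inE mem_imset; last exact: inl_inj.
by rewrite orbC; case: imsetP => // -[].
Qed.

Lemma mem_inr_disjoint_gunion (T U : finType) (G : graph T) (H : graph U) p :
  (inr p \in vset (disjoint_gunion G H)) = (p \in vset H).
Proof.
rewrite inE (mem_imset _ _ (@inr_inj _ _)).
by case: imsetP => // -[].
Qed.

Lemma adj_inl_disjoint_gunion (T U : finType) (G : graph T) (H : graph U) p q :
  adj G p q -> adj (disjoint_gunion G H) (inl p) (inl q).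
Proof. by rewrite adj_gunion adj_gimage => ->. Qed.

Lemma adj_inr_disjoint_gunion (T U : finType) (G : graph T) (H : graph U) p q :
  adj H p q -> adj (disjoint_gunion G H) (inr p) (inr q).
Proof. by rewrite adj_gunion orbC adj_gimage => ->. Qed.

Lemma rel_graph_sub (T : finType) (V W : {set T}) (r : rel T) :
  V \subset W -> subgraph (rel_graph V r) (rel_graph W r).
Proof.
move=> VW; rewrite /subgraph VW /=; apply/subsetP=> e; rewrite !inE.
case/exists_inP=> u uV /exists_inP[v vV uv]; apply/exists_inP; exists u.
  exact: (subsetP VW).
by apply/exists_inP; exists v => //; exact: (subsetP VW).
Qed.

(** * Geodesics through a vertex as pairs of geodesics *)

Section Joining.
Variables (T : finType) (G : graph T).

Lemma adj_spg u v (s t : #|T|.-bseq T) : adj (spg G u v) s t =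
  [&& geodesic G u v s, geodesic G u v t & differ_in_one_vertex s t].
Proof.
by rewrite adj_rel_differ !inE.
Qed.

Definition through u v w : {set #|T|.-bseq T} :=
  [set s in geodesics G u v | w \in (s : seq T)].

(** The target type bounds the length, so a concatenation that is too long yields a default value;
    [joinE] shows that this does not happen for the pairs considered. *)
Definition join (p : #|T|.-bseq T * #|T|.-bseq T) : #|T|.-bseq T :=
  insub_bseq #|T| (p.1 ++ behead p.2).

Variables u w v : T.
Hypothesis dist_uwv : minn #|T| (dist G u w + dist G w v) <= dist G u v.

Let V := setX (geodesics G u w) (geodesics G w v).

Lemma joinE p : p \in V -> join p = p.1 ++ behead p.2 :> seq T.
Proof.
rewrite !inE => /andP[gp gq]; apply: insubdK; rewrite -topredE /=.
exact: geodesic_size_le (geodesic_join dist_uwv gp gq).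
Qed.

Lemma join_through p : p \in V -> join p \in through u v w.
Proof.
move=> pV; move: (pV); rewrite !inE joinE // => /andP[gp gq].
by rewrite (geodesic_join dist_uwv gp gq) mem_cat (geodesic_mem_last gp).
Qed.

(** All geodesics from [u] to [w] have the same length, so the place of the cut is determined; the
    vertex removed by [behead] is always [w]. *)
Lemma join_inj : {in V &, injective join}.
Proof.
move=> [p q] [p' q'] pV qV /(congr1 (fun s : #|T|.-bseq T => s : seq T)).
rewrite !joinE //=; move: pV qV; rewrite !inE /= => /andP[gp gq] /andP[gp' gq'].
move/eqP; rewrite eqseq_cat ?(geodesic_size gp) ?(geodesic_size gp') //.
have [r eq] := walk_head (geodesic_walk gq).
have [r' eq'] := walk_head (geodesic_walk gq').
rewrite eq eq' /= => /andP[/eqP/val_inj-> /eqP err]; congr (_, _).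
by apply: val_inj; rewrite /= eq eq' err.
Qed.

Lemma join_imset : join @: V = through u v w.
Proof.
apply/setP=> s; apply/imsetP/idP => [[p pV ->]|]; first exact: join_through.
rewrite !inE => /andP[gs ws]; have [p [q [gp gq es]]] := geodesic_split gs ws.
have pV : (Bseq (geodesic_size_le gp), Bseq (geodesic_size_le gq)) \in V.
  by rewrite !inE /= gp gq.
exists (Bseq (geodesic_size_le gp), Bseq (geodesic_size_le gq)) => //.
by apply: val_inj; rewrite /= joinE.
Qed.

Lemma adj_cartesian_spg : {in V &, forall p q,
  adj (cartesian (spg G u w) (spg G w v)) p q = differ_in_one_vertex (join p) (join q)}.
Proof.
move=> p q pV qV; rewrite adj_cartesian pV qV !adj_spg !joinE //=; move: pV qV; rewrite !inE.
move=> /andP[gp1 gp2] /andP[gq1 gq2]; rewrite gp1 gp2 gq1 gq2 /=.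
rewrite (differ_in_one_vertex_join gp1 gq1 gp2 gq2) !val_eqE //.
Qed.

Lemma iso_through :
  iso (rel_graph (through u v w) (fun s t => differ_in_one_vertex s t))
      (cartesian (spg G u w) (spg G w v)).
Proof.
apply: iso_sym; apply: (iso_imset (f := join)).
- exact: join_inj.
- exact: join_imset.
- by move=> p q pV qV; rewrite adj_cartesian_spg // adj_rel_differ !join_through.
Qed.

End Joining.

(** * Geodesics across a two-vertex cut *)

Section TwoVertexCut.
Variables (T : finType) (G : graph T) (x y a b : T).
Hypothesis cut_xy : forall s, walk G a b s -> (x \in s) || (y \in s).

Local Notation d := (dist G).

(** A geodesic meets [x] or [y], so its length is one of the two sums, and the one through [x] is
    the smaller. With no geodesic, the distance is [#|T|]. *)
Lemma dist_cut : d a x + d x b <= d a y + d y b ->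
  minn #|T| (d a x + d x b) <= d a b.
Proof.
move=> le_xy; case: (ltnP (d a b) #|T|) => [/dist_geodesic[s gs]|]; last by lia.
case/orP: (cut_xy (geodesic_walk gs)) => /(geodesic_mem_dist gs); lia.
Qed.

(** A geodesic meeting [y] would have length [d a y + d y b], exceeding the upper bound
    [d a x + d x b] from the triangle inequality. *)
Lemma spg_through : d a x + d x b < d a y + d y b ->
  spg G a b = rel_graph (through G a b x) (fun s t => differ_in_one_vertex s t).
Proof.
move=> lt_xy; congr rel_graph; apply/setP=> s; rewrite !inE.
apply/idP/andP=> [gs|[]//]; split=> //.
case/orP: (cut_xy (geodesic_walk gs)) => // /(geodesic_mem_dist gs).
have := dist_triangle G x a b; lia.
Qed.

Lemma iso_spg_cut : d a x + d x b < d a y + d y b ->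
  iso (spg G a b) (cartesian (spg G a x) (spg G x b)).
Proof.
by move=> lt_xy; rewrite spg_through //; apply: iso_through; apply: dist_cut; exact: ltnW.
Qed.

(* If [s] meets [x] and [t] meets [y], they differ both at index [d a x] and at
   index [d a y]. *)
Lemma differ_same_cut s t : d a x != d a y ->
    geodesic G a b s -> geodesic G a b t -> differ_in_one_vertex s t ->
  (x \in s) && (x \in t) || (y \in s) && (y \in t).
Proof.
wlog xs : s t / x \in s.
  move=> IH neq gs gt st; have [xs|xNs] := orP (orbN (x \in s)).
    exact: (IH s t xs neq gs gt st).
  have [xt|xNt] := orP (orbN (x \in t)).
    have := IH t s xt neq gt gs; rewrite differ_in_one_vertex_sym => /(_ st).
    by rewrite (negPf xNs) andbF /= andbC.
  have := cut_xy (geodesic_walk gs); have := cut_xy (geodesic_walk gt).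
  by rewrite (negPf xNs) (negPf xNt) /= => -> ->.
move=> neq gs gt st; have [xt|xNt] := orP (orbN (x \in t)); first by rewrite xs xt.
have := cut_xy (geodesic_walk gt); rewrite xs (negPf xNt) /= => yt; rewrite ?yt ?andbT.
apply: contraNT xNt => yNs.
have nthx := nth_geodesic x gs xs; have nthy := nth_geodesic x gt yt.
have lt_t z : z \in t -> d a z < size t.
  by move=> zt; rewrite (geodesic_size gt) (geodesic_mem_dist gt zt) ltnS leq_addr.
have lt_s z : z \in s -> d a z < size s.
  by move=> zs; rewrite (geodesic_size gs) (geodesic_mem_dist gs zs) ltnS leq_addr.
have ney : nth x s (d a y) != nth x t (d a y).
  rewrite nthy; apply: contra yNs => /eqP <-; apply: mem_nth.
  by rewrite (geodesic_size gs) -(geodesic_size gt) lt_t.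
have := differ_in_one_vertexE st ney neq; rewrite nthx => ->; apply: mem_nth.
by rewrite (geodesic_size gt) -(geodesic_size gs) lt_s.
Qed.

(** Adjacency forces [d a y = (d a x).+1], so a geodesic containing both vertices has them at
    consecutive indices. *)
Lemma mem_cut_edge s : adj G x y -> d a x < d a y -> geodesic G a b s ->
  [set x; y] \in path_edges s = (x \in s) && (y \in s).
Proof.
move=> xy lt_xy gs.
apply/mapP/andP=> [[[z w] /= zw /set2_eq exy]|[xs ys]].
  have [zs ws] : z \in s /\ w \in s.
    have /(nthP (z, w))[i] := zw; rewrite size_zip size_behead => lti.
    rewrite nth_zip_cond size_zip size_behead lti => -[<- <-].
    rewrite nth_behead !mem_nth //; move: lti; rewrite leq_min => /andP[]; lia.
  by case: exy => [] [-> ->].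
have dy : d a y = (d a x).+1.
  have := dist_triangle G x a y; have := dist_adj xy; lia.
have lt_s : (d a x).+1 < size s.
  by rewrite (geodesic_size gs) (geodesic_mem_dist gs ys) dy ltnS leq_addr.
have lt_zip : d a x < size (zip s (behead s)).
  rewrite size_zip size_behead; case: (size s) lt_s => // n; rewrite !ltnS => lt_n.
  by rewrite leq_min lt_n leqW.
exists (x, y) => //; apply/(nthP (x, x)); exists (d a x) => //.
rewrite nth_zip_cond lt_zip nth_behead.
by rewrite (nth_geodesic x gs xs) -dy (nth_geodesic x gs ys).
Qed.

End TwoVertexCut.

(** * The matching case and the union case *)

Section TwoVertexCutCases.
Variables (T : finType) (G : graph T) (x y a b : T).
Hypotheses (xy : adj G x y).
Hypothesis cut_xy : forall s, walk G a b s -> (x \in s) || (y \in s).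

Local Notation d := (dist G).
Let Px := cartesian (spg G a x) (spg G x b).
Let Py := cartesian (spg G a y) (spg G y b).
Let D := disjoint_gunion Px Py.

Definition join_sum (P : #|T|.-bseq T * #|T|.-bseq T + #|T|.-bseq T * #|T|.-bseq T) :=
  match P with inl p | inr p => join p end.

Lemma spg_matching : d a x = d a y -> d x b = d y b ->
  exists (K : graph _) (M : {set {set _}}),
    [/\ vset K = vset D, eset K = eset D :|: M,
        matching_between (ginl _ Px) (ginr _ Py) M & iso (spg G a b) K].
Proof.
move=> eq_a eq_b.
have cut_yx s : walk G a b s -> (y \in s) || (x \in s).
  by rewrite orbC; exact: cut_xy.
have le_x : minn #|T| (d a x + d x b) <= d a b.
  by apply: (dist_cut cut_xy); rewrite eq_a eq_b.
have le_y : minn #|T| (d a y + d y b) <= d a b.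
  by apply: (dist_cut cut_yx); rewrite eq_a eq_b.
have neq_xy : x != y by have [] := adj_vset xy.
(* Both vertices would occupy the same index [d a x = d a y]. *)
have notboth s : geodesic G a b s -> x \in s -> y \in s -> False.
  move=> gs xs ys; move/eqP: neq_xy; apply.
  by rewrite -(nth_geodesic x gs xs) eq_a (nth_geodesic x gs ys).
have inlV p : (inl p \in vset D) = (p \in vset Px) by exact: mem_inl_disjoint_gunion.
have inrV p : (inr p \in vset D) = (p \in vset Py) by exact: mem_inr_disjoint_gunion.
have joinx p : p \in vset Px -> geodesic G a b (join p) /\ x \in (join p : seq T).
  by move/(join_through le_x); rewrite !inE => /andP[].
have joiny p : p \in vset Py -> geodesic G a b (join p) /\ y \in (join p : seq T).
  by move/(join_through le_y); rewrite !inE => /andP[].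
have inj_J : {in vset D &, injective join_sum}.
  move=> [p|p] [q|q]; rewrite ?inlV ?inrV /= => pV qV.
  - by move/(join_inj le_x pV qV) ->.
  - have [gp xp] := joinx p pV; have [gq yq] := joiny q qV => epq.
    by case: (notboth _ gp xp); rewrite epq.
  - have [gp xp] := joiny p pV; have [gq yq] := joinx q qV => epq.
    by case: (notboth _ gq yq); rewrite -epq.
  - by move/(join_inj le_y pV qV) ->.
have im_J : join_sum @: vset D = geodesics G a b.
  apply/setP=> s; apply/imsetP/idP => [[[p|p]]|gs].
  - by rewrite inlV => /joinx[gp _] ->; rewrite inE.
  - by rewrite inrV => /joiny[gp _] ->; rewrite inE.
  have gs' : geodesic G a b s by rewrite inE in gs.
  case/orP: (cut_xy (geodesic_walk gs')) => zs.
    have : s \in through G a b x by rewrite inE gs zs.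
    by rewrite -(join_imset le_x) => /imsetP[p pV ->]; exists (inl p); rewrite ?inlV.
  have : s \in through G a b y by rewrite inE gs zs.
  by rewrite -(join_imset le_y) => /imsetP[p pV ->]; exists (inr p); rewrite ?inrV.
(* [K] is the shortest path graph pulled back along the bijection [join_sum], so the isomorphism is
   immediate and only its edges need to be compared with those of [D]. *)
pose K := rel_graph (vset D) (fun P Q => differ_in_one_vertex (join_sum P) (join_sum Q)).
have adjK P Q : adj K P Q = [&& P \in vset D, Q \in vset D &
    differ_in_one_vertex (join_sum P) (join_sum Q)].
  rewrite adj_rel_graph; last by move=> ? ? _ _; exact: differ_in_one_vertex_sym.
  case: (eqVneq P Q) => //= ->; rewrite !andbF.
  by apply/esym/and3P => -[_ _ /differ_in_one_vertex_neq]; rewrite eqxx.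
have adjKx p q : p \in vset Px -> q \in vset Px -> adj K (inl p) (inl q) = adj Px p q.
  by move=> pV qV; rewrite adjK !inlV pV qV (adj_cartesian_spg le_x).
have adjKy p q : p \in vset Py -> q \in vset Py -> adj K (inr p) (inr q) = adj Py p q.
  by move=> pV qV; rewrite adjK !inrV pV qV (adj_cartesian_spg le_y).
(* Within one copy [K] and [D] have the same edges, so every additional edge runs between the
   copies. *)
have crossM E : E \in eset K :\: eset D -> exists p q,
    [/\ p \in vset Px, q \in vset Py, E = [set inl p; inr q] & adj K (inl p) (inr q)].
  case/setDP=> EK END; have [P [Q eE]] := eset_adj EK.
  have aPQ : adj K P Q by rewrite /adj -eE.
  move: (aPQ) END eE; rewrite {1}adjK => /and3P[]; case: P aPQ => [p|p]; case: Q => [q|q] aPQ;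
    rewrite ?inlV ?inrV => pV qV _ END eE.
  - by case/negP: END; rewrite eE; apply: adj_inl_disjoint_gunion; rewrite -adjKx.
  - by exists p, q.
  - by exists q, p; split => //; [rewrite eE setUC | rewrite adj_sym].
  - by case/negP: END; rewrite eE; apply: adj_inr_disjoint_gunion; rewrite -adjKy.
(* At index [d a x] one geodesic has [x] and the other [y]; this is their only difference. *)
have cross_nth p q j : p \in vset Px -> q \in vset Py -> adj K (inl p) (inr q) ->
    j != d a x -> nth x (join p) j = nth x (join q) j.
  move=> pV qV; rewrite adjK => /and3P[_ _ dpq].
  have [gp xp] := joinx p pV; have [gq yq] := joiny q qV.
  apply: (differ_in_one_vertexE dpq).
  by rewrite (nth_geodesic x gp xp) eq_a (nth_geodesic x gq yq).
have eq_join (s t : #|T|.-bseq T) : geodesic G a b s -> geodesic G a b t ->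
    (forall j, nth x s j = nth x t j) -> s = t.
  move=> gs gt est; apply: val_inj; apply: (eq_from_nth (x0 := x)) => // .
  by rewrite (geodesic_size gs) (geodesic_size gt).
(* Two partners of [p] agree with [p] away from index [d a x], and both have [y] there. *)
have uniq_x p q q' : p \in vset Px -> q \in vset Py -> q' \in vset Py ->
    adj K (inl p) (inr q) -> adj K (inl p) (inr q') -> q = q'.
  move=> pV qV q'V apq apq'; apply: (join_inj le_y qV q'V).
  have [gq yq] := joiny q qV; have [gq' yq'] := joiny q' q'V.
  apply: eq_join => // j; have [->|jx] := eqVneq j (d a x).
    by rewrite eq_a (nth_geodesic x gq yq) (nth_geodesic x gq' yq').
  by rewrite -(cross_nth p q) // (cross_nth p q').
have uniq_y p p' q : p \in vset Px -> p' \in vset Px -> q \in vset Py ->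
    adj K (inl p) (inr q) -> adj K (inl p') (inr q) -> p = p'.
  move=> pV p'V qV apq apq'; apply: (join_inj le_x pV p'V).
  have [gp xp] := joinx p pV; have [gp' xp'] := joinx p' p'V.
  apply: eq_join => // j; have [->|jx] := eqVneq j (d a x).
    by rewrite (nth_geodesic x gp xp) (nth_geodesic x gp' xp').
  by rewrite (cross_nth p q) // (cross_nth p' q).
exists K, (eset K :\: eset D); split => //.
- rewrite setUC setDE setUIl [_ :|: _ in X in _ :&: X]setUC setUCr setIT.
  apply/esym/setUidPl/subsetP => E; rewrite inE => /orP[]/imsetP[F FP ->].
    have [p [q eF]] := eset_adj FP; rewrite eF in FP *.
    have := FP; rewrite -[_ \in eset Px]/(adj Px p q) adj_cartesian => /and3P[pV qV _].
    by rewrite imsetU1 imset_set1 -[_ \in eset K]/(adj K _ _) adjKx.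
  have [p [q eF]] := eset_adj FP; rewrite eF in FP *.
  have := FP; rewrite -[_ \in eset Py]/(adj Py p q) adj_cartesian => /and3P[pV qV _].
  by rewrite imsetU1 imset_set1 -[_ \in eset K]/(adj K _ _) adjKy.
- split=> [E /crossM[p [q [pV qV -> _]]]|].
    by exists (inl p), (inr q); split; rewrite // imset_f.
  apply/trivIsetP => E F /crossM[p [q [pV qV -> apq]]] /crossM[p' [q' [p'V q'V -> apq']]].
  apply: contraR; rewrite -setI_eq0 => /set0Pn[P]; rewrite !inE => /andP[].
  case/orP=> /eqP->; rewrite ?orbF /=.
    move=> /eqP[epp']; subst p'.
    by rewrite (uniq_x p q q').
  by move=> /eqP[eqq']; subst q'; rewrite (uniq_y p p' q).
- apply: iso_sym; apply: (iso_imset (f := join_sum)) => //.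
  move=> P Q PV QV; rewrite adjK PV QV adj_spg.
  have gJ R : R \in vset D -> geodesic G a b (join_sum R).
    by move=> RV; have := imset_f join_sum RV; rewrite im_J inE.
  by rewrite !gJ.
Qed.

(** The cut property covers the vertices and [differ_same_cut] the edges. The opposite strict order
    follows by exchanging [x] and [y]. *)
Lemma spg_gunion : d a x < d a y ->
  let H z := rel_graph (through G a b z) (fun s t => differ_in_one_vertex s t) in
  [/\ subgraph (H x) (spg G a b) && subgraph (H y) (spg G a b),
      spg G a b = gunion (H x) (H y)
    & vset (H x) :&: vset (H y) =
        [set s in geodesics G a b | [set x; y] \in path_edges s]].
Proof.
move=> lt_xy H; have subH z : subgraph (H z) (spg G a b).
  by apply: rel_graph_sub; apply/subsetP=> s; rewrite inE => /andP[].
split; first by rewrite !subH.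
  apply: graph_eq.
    apply/setP=> s; rewrite !inE -andb_orr; case: (boolP (geodesic G a b s)) => //= gs.
    by rewrite (cut_xy (geodesic_walk gs)).
  apply: eset_eqP => s t; rewrite adj_gunion !adj_rel_differ !inE.
  case: (boolP (geodesic G a b s)) => //= gs.
  case: (boolP (geodesic G a b t)) => /= gt; last by rewrite !andbF.
  case: (boolP (differ_in_one_vertex s t)) => st; rewrite ?andbF //= !andbT.
  by rewrite (differ_same_cut cut_xy _ gs gt st) // neq_ltn lt_xy.
apply/setP=> s; rewrite !inE; case: (boolP (geodesic G a b s)) => //= gs.
by rewrite (mem_cut_edge xy lt_xy gs).
Qed.

End TwoVertexCutCases.

(** * Adjacency and crossing walks in a two-sum *)

Section TwoSum.
Variables (T : finType) (G1 G2 : graph T) (x y : T).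
Hypothesis hE : eset G1 :&: eset G2 = [set [set x; y]].
Hypothesis hV : vset G1 :&: vset G2 = [set x; y].

Local Notation G := (gunion G1 G2).

Lemma two_sum_adj : adj G1 x y /\ adj G2 x y.
Proof. by apply/setIP; rewrite hE set11. Qed.

Lemma two_sum_vsetI z : z \in vset G1 -> z \in vset G2 -> z = x \/ z = y.
Proof. by move=> z1 z2; apply/set2P; rewrite -hV inE z1 z2. Qed.

(** An edge of [G2] with both ends in [G1] can only join [x] and [y], and that edge is in [G1]
    already. *)
Lemma adj_two_sum u v : u \in vset G1 -> v \in vset G1 -> adj G u v = adj G1 u v.
Proof.
move=> u1 v1; rewrite adj_gunion; apply/orP/idP => [[//|uv]|]; last by left.
have [u2 v2 neq] := adj_vset uv; have [xy _] := two_sum_adj.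
move: neq; case: (two_sum_vsetI u1 u2) => ->; case: (two_sum_vsetI v1 v2) => ->;
  by rewrite ?eqxx // adj_sym.
Qed.

(** As long as the walk is outside [G2], its next edge belongs to [G1] and keeps it in [G1]. It ends
    in [G2], so some vertex lies in both. *)
Lemma two_sum_crossing u v s : u \in vset G1 -> v \in vset G2 -> walk G u v s ->
  (x \in s) || (y \in s).
Proof.
move=> u1 v2 ws; suff [z zs [z1 z2]] : exists2 z, z \in s & z \in vset G1 /\ z \in vset G2.
  by case: (two_sum_vsetI z1 z2) => <-; rewrite zs ?orbT.
have [t et] := walk_head ws; subst s; move: ws => /= /and4P[_ /eqP lst _].
elim: t u u1 lst => [|w t IHt] u u1 /= lst.
  by exists u; rewrite ?mem_head // {2}lst.
case: (boolP (u \in vset G2)) => [u2 _|uN2]; first by exists u; rewrite ?mem_head.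
rewrite adj_gunion => /andP[/orP[/adj_vset[_ w1 _]|/adj_vset[u2]] pt]; last first.
  by rewrite u2 in uN2.
by have [z zs z12] := IHt w w1 lst pt; exists z; rewrite // inE zs orbT.
Qed.

End TwoSum.

(** * Geodesics between two vertices of one summand *)

Section TwoSumGeodesics.
Variables (T : finType) (G1 G2 : graph T) (x y : T).
Hypothesis hE : eset G1 :&: eset G2 = [set [set x; y]].
Hypothesis hV : vset G1 :&: vset G2 = [set x; y].

Local Notation G := (gunion G1 G2).

(* A geodesic leaving [G1] would leave it through one end of the edge [xy] and
   come back through the other, and this edge is a shortcut. *)
Lemma geodesic_two_sum_vset u v s : u \in vset G1 -> v \in vset G1 ->
  geodesic G u v s -> {subset s <= vset G1}.
Proof.
move=> u1 v1 gs w ws; apply: contraT => wN1.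
have /setUP[w1|w2] := walk_vset (geodesic_walk gs) ws; first by rewrite w1 in wN1.
have hE' : eset G2 :&: eset G1 = [set [set x; y]] by rewrite setIC.
have hV' : vset G2 :&: vset G1 = [set x; y] by rewrite setIC.
have [x1 y1] : x \in vset G1 /\ y \in vset G1.
  by have [/adj_vset[]] := two_sum_adj hE.
have pick (s' : seq T) : (x \in s') || (y \in s') -> exists2 z, z \in s' & (z == x) || (z == y).
  by case/orP=> zs; [exists x | exists y]; rewrite ?eqxx ?orbT.
have neq_w z : (z == x) || (z == y) -> z != w.
  by move=> zxy; apply: contra wN1 => /eqP <-; case/pred2P: zxy => ->.
have us : uniq s by move: gs => /andP[]; rewrite is_pathE => /andP[].
have sz := geodesic_size gs; have wk := geodesic_walk gs.
case/splitPr: ws us sz wk {gs} => s1 s2 us sz; rewrite walk_cat => /andP[wk1 wk2].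
(* The walk from [u] to [w] crosses into [G2] and the walk from [w] to [v] crosses back. Since [w]
   is neither [x] nor [y], the crossing vertices lie strictly on either side of it. *)
have [z zs1 zxy] : exists2 z, z \in s1 & (z == x) || (z == y).
  have [z] := pick _ (two_sum_crossing hV u1 w2 wk1); rewrite mem_rcons inE => zs zxy.
  by exists z => //; move: zs; rewrite (negPf (neq_w z zxy)).
have [z' zs2 zxy'] : exists2 z, z \in s2 & (z == x) || (z == y).
  have wk2' : walk (gunion G2 G1) w v (w :: s2) by rewrite gunionC.
  have [z'] := pick _ (two_sum_crossing hV' w2 v1 wk2'); rewrite inE => zs zxy'.
  by exists z' => //; move: zs; rewrite (negPf (neq_w z' zxy')).
case/splitPr: zs1 us sz wk1 => t1 t2; case/splitPr: zs2 wk2 => t3 t4 wk2 us sz wk1.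
have adj_zz' : adj G z z'.
  have neq : z != z'.
    apply/eqP => ezz; move: us; rewrite ezz -catA cat_uniq => /and3P[_ _].
    by rewrite /= mem_cat inE mem_cat mem_head !orbT.
  have [xy _] := two_sum_adj hE.
  case/pred2P: zxy neq => ->; case/pred2P: zxy' => ->; rewrite ?eqxx // => _;
    rewrite adj_gunion ?xy // (adj_sym G1) xy //.
have [zV z'V _] := adj_vset adj_zz'.
have wk3 : walk G z z' [:: z; z'] by rewrite /= !eqxx zV z'V adj_zz'.
have wk4 : walk G u v (t1 ++ z :: z' :: t4).
  move: wk1; rewrite rcons_cat walk_cat => /andP[wk1 _].
  move: wk2; rewrite -cat_cons walk_cat => /andP[_ wk2].
  by rewrite walk_cat wk1 -[z :: _]/([:: z] ++ z' :: t4) walk_cat wk3.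
have := walk_dist wk4; move: sz; rewrite !size_cat /= !size_cat /=; clear; lia.
Qed.

Lemma walk_two_sum u v s : {subset s <= vset G1} -> walk G u v s = walk G1 u v s.
Proof.
move=> s1; case: s s1 => //= w t s1; congr [&& _, _ & _].
have allG H : vset G1 \subset vset H -> all (mem (vset H)) (w :: t).
  by move=> /subsetP sub; apply/allP => z /s1; exact: sub.
rewrite -[_ && all _ _]/(all (mem (vset G1 :|: vset G2)) (w :: t)).
rewrite (allG G) ?subsetUl // -[X in _ = X && _]/(all (mem (vset G1)) (w :: t)) (allG G1) //=.
elim: t w s1 {allG} => //= z t IHt w s1.
rewrite (adj_two_sum hE hV) ?s1 ?inE ?eqxx ?orbT // IHt // => c ct.
by rewrite s1 // inE ct orbT.
Qed.

(** Both graphs share the ambient type, so an infinite distance has the same value [#|T|] in each;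
    when finite, a geodesic of either graph is a walk of the other. *)
Lemma dist_two_sum u v : u \in vset G1 -> v \in vset G1 -> dist G u v = dist G1 u v.
Proof.
move=> u1 v1; apply/eqP; rewrite eqn_leq; apply/andP; split.
  case: (ltnP (dist G1 u v) #|T|) => [/dist_geodesic[s gs]|].
    have ws := geodesic_walk gs.
    have := walk_two_sum u v (walk_vset ws); rewrite ws => /walk_dist.
    by rewrite (geodesic_size gs).
  exact: leq_trans (dist_le_card _ _ _).
case: (ltnP (dist G u v) #|T|) => [/dist_geodesic[s gs]|].
  have := walk_two_sum u v (geodesic_two_sum_vset u1 v1 gs).
  rewrite (geodesic_walk gs) => /esym/walk_dist.
  by rewrite (geodesic_size gs).
exact: leq_trans (dist_le_card _ _ _).
Qed.

Lemma spg_two_sum u v : u \in vset G1 -> v \in vset G1 -> spg G u v = spg G1 u v.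
Proof.
move=> u1 v1; congr rel_graph; apply/setP => s; rewrite !inE.
apply/idP/idP => gs.
  have := gs; rewrite !geodesicE dist_two_sum // walk_two_sum //.
  exact: geodesic_two_sum_vset gs.
have := gs; rewrite !geodesicE dist_two_sum // walk_two_sum //.
exact: walk_vset (geodesic_walk gs).
Qed.

End TwoSumGeodesics.

(** * The four cases for the two-sum *)

Theorem theorem15 (T : finType) (G1 G2 : graph T) (e : {set T}) (x y a b : T)
    (hE : eset G1 :&: eset G2 = [set e])
    (he : e = [set x; y])
    (hV : vset G1 :&: vset G2 = [set x; y])
    (ha : a \in vset G1)
    (hb : b \in vset G2)
    (hab : [set a; b] :&: [set x; y] = set0) :
  let G := gunion G1 G2 in
  let d := dist G in
  let Px := cartesian (spg G1 a x) (spg G2 x b) in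
  let Py := cartesian (spg G1 a y) (spg G2 y b) in
  let case_i := d a x = d a y /\ d x b = d y b in
  let case_ii := (d a x <= d a y /\ d x b < d y b) \/
                 (d a x < d a y /\ d x b <= d y b) in
  let case_iii := (d a y <= d a x /\ d y b < d x b) \/
                  (d a y < d a x /\ d y b <= d x b) in
  [/\ case_i ->
        exists (K : graph _) (M : {set {set _}}),
          [/\ vset K = vset (disjoint_gunion Px Py),
              eset K = eset (disjoint_gunion Px Py) :|: M,
              matching_between (ginl _ Px) (ginr _ Py) M
            & iso (spg G a b) K],
      case_ii -> iso (spg G a b) Px,
      case_iii -> iso (spg G a b) Py
    & ~ case_i -> ~ case_ii -> ~ case_iii ->
        exists Hx Hy : graph (#|T|.-bseq T),
          [/\ subgraph Hx (spg G a b) && subgraph Hy (spg G a b),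
              iso Hx Px,
              iso Hy Py,
              spg G a b = gunion Hx Hy
            & vset Hx :&: vset Hy =
                [set s in geodesics G a b | e \in path_edges s]]].
Proof.
subst e; have [xy1 xy2] := two_sum_adj hE; move=> G d.
have [x1 y1 _] := adj_vset xy1; have [x2 y2 _] := adj_vset xy2.
have hE' : eset G2 :&: eset G1 = [set [set x; y]] by rewrite setIC.
have hV' : vset G2 :&: vset G1 = [set x; y] by rewrite setIC.
have spg1 z : z \in vset G1 -> spg G1 a z = spg G a z.
  by move=> z1; rewrite (spg_two_sum hE hV).
have spg2 z : z \in vset G2 -> spg G2 z b = spg G z b.
  by move=> z2; rewrite /G gunionC (spg_two_sum hE' hV').
rewrite !spg1 ?spg2 // => Px Py case_i case_ii case_iii.
have xy : adj G x y by rewrite adj_gunion xy1.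
have yx : adj G y x by rewrite adj_sym.
have cut_xy s : walk G a b s -> (x \in s) || (y \in s) by exact: two_sum_crossing.
have cut_yx s : walk G a b s -> (y \in s) || (x \in s) by rewrite orbC; exact: cut_xy.
(* Across the edge [xy], distances to [a] and to [b] change by at most one. *)
have dax := dist_triangle G x a y; have day := dist_triangle G y a x.
have dxb := dist_triangle G y x b; have dyb := dist_triangle G x y b.
have dxy := dist_adj xy; have dyx := dist_adj yx.
split.
- by case; exact: spg_matching.
- by move=> ii; apply: (iso_spg_cut cut_xy); rewrite -/d; move: ii; rewrite /case_ii; lia.
- by move=> iii; apply: (iso_spg_cut cut_yx); rewrite -/d; move: iii; rewrite /case_iii; lia.
rewrite /case_i /case_ii /case_iii => Ni Nii Niii.
(* Outside the first three cases the two comparisons are strict and opposite; each gap is exactly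
   one, so the sums agree. *)
have eq_d : d a x + d x b = d a y + d y b by rewrite /d in Ni Nii Niii *; lia.
exists (rel_graph (through G a b x) (fun s t => differ_in_one_vertex s t)).
exists (rel_graph (through G a b y) (fun s t => differ_in_one_vertex s t)).
have isox := iso_through (dist_cut cut_xy (eq_leq eq_d)).
have isoy := iso_through (dist_cut cut_yx (eq_leq (esym eq_d))).
case: (ltngtP (d a x) (d a y)) => [lt_xy|lt_yx|eq_a].
- by have [] := spg_gunion xy cut_xy lt_xy.
- have [] := spg_gunion yx cut_yx lt_yx.
  by rewrite andbC gunionC setIC [ [set y; x] ]setUC.
(* With equal sums, [d a x = d a y] would give the first case. *)
- by case: Ni; split=> //; move: eq_d; rewrite eq_a => /addnI.
Qed.
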